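(* (i) $\zeta_k(n)\in[1,2]$ for all positive integers $k,n$ with $k\leq n$. (ii) $\zeta_k(G)\leq \liminf_{n\to\infty}\zeta_k(n)$ for every positive integer $k$ and every fixed graph $G$. (iii) For every positive integer $k$, the limit $\lim_{n\to\infty}\zeta_k(n)$ exists.
   Context: All graphs are finite and simple, with at least one vertex. For a positive integer $k$, a $k$-dominating independent set ($k$-DIS) of a graph $G$ is a set $D\subseteq V(G)$ that induces no edge and such that every vertex $v\in V(G)\setminus D$ satisfies $|N(v)\cap D|\geq k$, where $N(v)$ is the set of neighbors of $v$. Let $\mathrm{mi}_k(G)$ denote the number of $k$-DISes of $G$, and let $\mathrm{mi}_k(n)$ denote the maximum of $\mathrm{mi}_k(G)$ over all graphs $G$ on $n$ vertices. For a graph $G$ on $n$ vertices let $\zeta_k(G):=\sqrt[n]{\mathrm{mi}_k(G)}$, and let $\zeta_k(n):=\sqrt[n]{\mathrm{mi}_k(n)}$. *)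

(* Defs.v *)
From HB Require Import structures.
From mathcomp Require Import all_boot all_order all_algebra.
From mathcomp Require Import all_classical all_reals all_analysis.

Set Implicit Arguments.
Unset Strict Implicit.
Unset Printing Implicit Defensive.

Import Order.TTheory GRing.Theory Num.Theory.
Import numFieldNormedType.Exports.

Local Open Scope ring_scope.

Definition simple_graph (T : finType) (e : rel T) : bool :=
  [forall x, ~~ e x x] && [forall x, forall y, e x y == e y x].

Definition neighbors (T : finType) (e : rel T) (v : T) : {set T} :=
  finset (e v).

Definition is_kDIS (k : nat) (T : finType) (e : rel T) (D : {set T}) : bool :=
  [forall u in D, forall v in D, ~~ e u v] &&
  [forall v in ~: D, (k <= #|neighbors e v :&: D|)%N].

Definition mi (k : nat) (T : finType) (e : rel T) : nat :=
  #|finset (is_kDIS k e)|.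

(* Up to isomorphism a graph on n vertices has vertex set 'I_n; its adjacency
   relation is encoded by the set of its adjacent ordered pairs, so that the
   maximum ranges over a finite type. *)
Definition adj_rel (n : nat) (A : {set 'I_n * 'I_n}) : rel 'I_n :=
  fun x y => (x, y) \in A.

Definition mi_max (k n : nat) : nat :=
  (\max_(A : {set 'I_n * 'I_n} | simple_graph (adj_rel A))
     mi k (adj_rel A))%N.

(* For n = 0 this is x `^ 0 = 1. *)
Definition nth_root (R : realType) (n : nat) (x : R) : R :=
  powR x (n%:R^-1).

Definition zeta (R : realType) (k : nat) (T : finType) (e : rel T) : R :=
  nth_root #|T| (mi k e)%:R.

Definition zeta_max (R : realType) (k n : nat) : R :=
  nth_root n (mi_max k n)%:R.

Arguments zeta R k {T} e.

(* Main.v *)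
Require Import Defs.
From HB Require Import structures.
From mathcomp Require Import all_boot all_order all_algebra.
From mathcomp Require Import all_classical all_reals all_analysis.

Import Order.TTheory GRing.Theory Num.Theory.
Import numFieldNormedType.Exports.

Local Open Scope ring_scope.

(** Write a_n for mi_k(n).  The whole theorem rests on the inequality
    a_m * a_n <= a_(m+n).  It holds because the set formed from a k-DIS in each
    of two graphs is a k-DIS of their disjoint union, and different pairs give
    different sets ([mi_disjoint_union]); applied to two extremal graphs this is
    [mi_max_supermul].  Moreover 1 <= a_n <= 2 ^ n: the edgeless graph has its
    whole vertex set as a k-DIS, and a k-DIS is one of the 2 ^ n vertex sets.
    This already places zeta_k(n) in [1, 2].

    The rest is the multiplicative form of Fekete's lemma
    ([supermul_root_cvg]): for such a sequence, z_n = a_n ^ (1/n) converges to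
    its supremum.  Cutting n vertices into blocks of N gives a bound
    z_N <= z_n * a_N ^ (1/n) ([supermul_root_le]) in which the last factor
    tends to 1 when N is fixed.  Hence z_n is eventually above anything smaller
    than z_N, for every N.

    Thus zeta_k(n) has a limit, equal to sup_n zeta_k(n).  A graph G on N
    vertices has zeta_k(G) <= zeta_k(N), so zeta_k(G) is at most this supremum,
    which is also the lower limit. *)

(** * Independent k-dominating sets of a single graph *)

Lemma simple_graphP {T : finType} {e : rel T} :
  reflect (irreflexive e /\ symmetric e) (simple_graph e).
Proof.
apply: (iffP andP) => [[/forallP eI /forallP eS]|[eI eS]].
  by split=> [x|x y]; [apply/negbTE/eI|apply/eqP; have /forallP := eS x].
by split; apply/forallP => x; [rewrite eI|apply/forallP => y; rewrite eS].
Qed.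

Lemma is_kDISP {k : nat} {T : finType} {e : rel T} {D : {set T}} :
  reflect ({in D &, forall u v, ~~ e u v} /\
           forall v, v \notin D -> (k <= #|neighbors e v :&: D|)%N)
          (is_kDIS k e D).
Proof.
apply: (iffP andP) => [[/forall_inP indD /forall_inP domD]|[indD domD]].
  split=> [u v uD vD|v vD]; first by have /forall_inP := indD u uD; apply.
  by apply: domD; rewrite inE.
split; last by apply/forall_inP => v; rewrite inE; exact: domD.
by apply/forall_inP => u uD; apply/forall_inP => v vD; exact: indD.
Qed.

Lemma mi_le_exp2 (k : nat) (T : finType) (e : rel T) : (mi k e <= 2 ^ #|T|)%N.
Proof.
by rewrite -cardsT -card_powerset powersetT subset_leq_card ?subsetT.
Qed.

Lemma mi_edgeless_gt0 (k : nat) (T : finType) (e : rel T) :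
  (forall x y, ~~ e x y) -> (0 < mi k e)%N.
Proof.
move=> e0; apply/card_gt0P; exists [set: T]; rewrite inE.
by apply/is_kDISP; split=> [u v _ _|v]; rewrite ?e0 ?inE.
Qed.

(** Preimage along an isomorphism embeds the k-DISes of one graph into those of
    the other; the opposite inequality is the same statement for the inverse. *)
Lemma mi_iso_le (k : nat) (S T : finType) (e : rel S) (e' : rel T)
    (f : S -> T) :
  bijective f -> (forall x y, e x y = e' (f x) (f y)) -> (mi k e' <= mi k e)%N.
Proof.
move=> [g fK gK] ef; have f_inj := can_inj fK.
pose pre (D : {set T}) := [set x | f x \in D].
have pre_inj : injective pre.
  move=> D E /setP DE; apply/setP => y.
  by have := DE (g y); rewrite !inE gK.
rewrite /mi -[leqLHS](card_imset _ pre_inj).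
apply/subset_leq_card/fintype.subsetP => X.
case/imsetP=> D + ->; rewrite !inE => /is_kDISP[indD domD].
apply/is_kDISP; split=> [u v|v]; rewrite !inE; first by rewrite ef; exact: indD.
move=> vD; apply: (leq_trans (domD _ vD)).
rewrite -[leqRHS](card_imset _ f_inj).
apply/subset_leq_card/fintype.subsetP => y; rewrite !inE => /andP[evy yD].
by apply/imsetP; exists (g y); rewrite ?gK // !inE ef gK evy.
Qed.

(** * Disjoint unions *)

Definition disjoint_union {S T : finType} (e : rel S) (e' : rel T) :
    rel (S + T)%type :=
  fun x y => match x, y with
             | inl u, inl v => e u v
             | inr u, inr v => e' u v
             | _, _ => false
             end.

Lemma disjoint_union_simple {S T : finType} (e : rel S) (e' : rel T) :
  simple_graph e -> simple_graph e' -> simple_graph (disjoint_union e e').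
Proof.
move=> /simple_graphP[eI eS] /simple_graphP[e'I e'S].
by apply/simple_graphP; split=> [[]|[x|x] [y|y]] /=.
Qed.

(** A pair of k-DISes is glued into a subset of the union.  A vertex outside the
    glued set keeps all the neighbors it had in its own summand, and there are
    no edges across, so both independence and k-domination carry over. *)
Lemma mi_disjoint_union (k : nat) (S T : finType) (e : rel S) (e' : rel T) :
  (mi k e * mi k e' <= mi k (disjoint_union e e'))%N.
Proof.
pose glue (D : {set S} * {set T}) : {set S + T} :=
  [set s | match s with inl x => x \in D.1 | inr y => y \in D.2 end].
have glue_inj : injective glue.
  move=> [D E] [D' E'] /setP DE; congr pair; apply/setP => x.
    by have := DE (inl x); rewrite !inE.
  by have := DE (inr x); rewrite !inE.
rewrite /mi -cardsX -[leqLHS](card_imset _ glue_inj).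
apply/subset_leq_card/fintype.subsetP => X.
case/imsetP=> -[D E] + ->; rewrite !inE /= => /andP[].
move=> /is_kDISP[indD domD] /is_kDISP[indE domE].
apply/is_kDISP; split=> [[u|u] [v|v]|[v|v]]; rewrite !inE //=.
- exact: indD.
- exact: indE.
- move=> /domD/leq_trans; apply; rewrite -[leqLHS](card_imset _ (@inl_inj S T)).
  apply/subset_leq_card/fintype.subsetP => y /imsetP[w + ->].
  by rewrite !inE.
- move=> /domE/leq_trans; apply; rewrite -[leqLHS](card_imset _ (@inr_inj S T)).
  apply/subset_leq_card/fintype.subsetP => y /imsetP[w + ->].
  by rewrite !inE.
Qed.

(** * The maximum over graphs on n vertices *)

Lemma mi_adj_le_mi_max (k n : nat) (A : {set 'I_n * 'I_n}) :
  simple_graph (adj_rel A) -> (mi k (adj_rel A) <= mi_max k n)%N.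
Proof. exact: (leq_bigmax_cond (F := fun A => mi k (adj_rel A))). Qed.

(** Enumerating the vertices carries any graph to one on the ordinals, where the
    maximum is taken. *)
Lemma mi_le_mi_max (k : nat) (T : finType) (e : rel T) :
  simple_graph e -> (mi k e <= mi_max k #|T|)%N.
Proof.
move=> /simple_graphP[eI eS].
pose A := [set p : 'I_#|T| * 'I_#|T| | e (enum_val p.1) (enum_val p.2)].
have A_simple : simple_graph (adj_rel A).
  by apply/simple_graphP; split=> [x|x y]; rewrite /adj_rel !inE.
apply: leq_trans (mi_adj_le_mi_max k _ _ A_simple).
apply: (@mi_iso_le _ _ _ _ _ enum_val) => [|x y]; last by rewrite /adj_rel inE.
exact: enum_val_bij.
Qed.

Lemma edgeless_simple (n : nat) : simple_graph (@adj_rel n finset.set0).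
Proof. by apply/simple_graphP; split=> [x|x y]; rewrite /adj_rel !inE. Qed.

Lemma mi_max_attained (k n : nat) :
  exists2 A : {set 'I_n * 'I_n},
    simple_graph (adj_rel A) & mi_max k n = mi k (adj_rel A).
Proof.
have [|A A_simple maxE]
  := @eq_bigmax_cond _ [pred A | simple_graph (@adj_rel n A)]
  (fun A => mi k (adj_rel A)).
  by apply/card_gt0P; exists finset.set0; rewrite inE edgeless_simple.
by exists A => //; rewrite -maxE; apply: eq_bigl.
Qed.

Lemma mi_max_gt0 (k n : nat) : (0 < mi_max k n)%N.
Proof.
apply: leq_trans (mi_adj_le_mi_max k _ _ (edgeless_simple n)).
by apply: mi_edgeless_gt0 => x y; rewrite /adj_rel inE.
Qed.

Lemma mi_max_le_exp2 (k n : nat) : (mi_max k n <= 2 ^ n)%N.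
Proof.
have [A _ ->] := mi_max_attained k n.
by rewrite -[X in (2 ^ X)%N](card_ord n) mi_le_exp2.
Qed.

Lemma mi_max_supermul (k m n : nat) :
  (mi_max k m * mi_max k n <= mi_max k (m + n))%N.
Proof.
have [A A_simple ->] := mi_max_attained k m.
have [B B_simple ->] := mi_max_attained k n.
apply: leq_trans (mi_disjoint_union _ _ _ _ _) _.
have := mi_le_mi_max k _ _ (disjoint_union_simple _ _ A_simple B_simple).
by rewrite card_sum !card_ord.
Qed.

(** * Roots of order n *)

Section Roots.
Context {R : realType}.
Implicit Types (x y : R) (n : nat).

Lemma nth_root_ge0 n x : 0 <= nth_root n x.
Proof. exact: powR_ge0. Qed.

Lemma ler_nth_root n x y : 0 <= x -> x <= y -> nth_root n x <= nth_root n y.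
Proof.
move=> x0 xy; apply: ge0_ler_powR => //; rewrite ?nnegrE ?invr_ge0 //.
exact: le_trans xy.
Qed.

Lemma nth_rootM n x y : 0 <= x -> 0 <= y ->
  nth_root n (x * y) = nth_root n x * nth_root n y.
Proof. exact: powRM. Qed.

Lemma nth_root_expn n x : (0 < n)%N -> 0 <= x -> nth_root n x ^+ n = x.
Proof.
move=> n0 x0; rewrite -powR_mulrn ?powR_ge0 // /nth_root -powRrM.
by rewrite mulVf ?pnatr_eq0 -?lt0n // powRr1.
Qed.

(** For x > 0 the n-th root is exp (ln x / n), and ln x / n tends to 0. *)
Lemma nth_root_cvg1 x :
  0 < x -> (nth_root n x @[n --> \oo] --> (1 : R))%classic.
Proof.
move=> x0; rewrite -cvg_shiftS.
suff : (expR (harmonic n * ln x) @[n --> \oo] --> expR 0)%classic.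
  by rewrite /nth_root /powR (gt_eqF x0) expR0.
apply: continuous_cvg; first exact: continuous_expR.
rewrite -[X in (_ --> X)%classic](mul0r (ln x)).
by apply: cvgM; [exact: cvg_harmonic|exact: cvg_cst].
Qed.

End Roots.

(** * Fekete's lemma for supermultiplicative sequences *)

Section Fekete.
Context {R : realType} (a : nat -> nat) (b : nat).
Hypothesis a_gt0 : forall n, (0 < a n)%N.
Hypothesis a_supermul : forall m n, (a m * a n <= a (m + n))%N.
Hypothesis a_le_exp : forall n, (a n <= b ^ n)%N.

Let z n : R := nth_root n (a n)%:R.

Lemma supermul_expn q N : (a N ^ q <= a (q * N))%N.
Proof.
elim: q => [|q IHq]; first by rewrite expn0 a_gt0.
rewrite expnS mulSn; apply: leq_trans (a_supermul _ _).
by rewrite leq_mul2l IHq orbT.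
Qed.

(** With q = n %/ N we have n <= (q + 1) * N, so a_N ^ n is at most
    (a_N ^ q * a_N) ^ N, and q blocks of length N fit into n.  The extra factor
    a_N pays for rounding n / N down to an integer. *)
Lemma supermul_expn_le N n : (0 < N)%N -> (a N ^ n <= (a n * a N) ^ N)%N.
Proof.
move=> N0; apply: (@leq_trans (a N ^ ((n %/ N).+1 * N))).
  by rewrite leq_pexp2l // ltnW // ltn_ceil.
rewrite expnM leq_exp2r // expnSr leq_mul2r; apply/orP; right.
apply: leq_trans (supermul_expn _ _) _.
rewrite [in leqRHS](divn_eq n N); apply: leq_trans (a_supermul _ _).
by rewrite leq_pmulr.
Qed.

(** This is the previous inequality after extraction of the (N * n)-th root. *)
Lemma supermul_root_le N n :
  (0 < N)%N -> (0 < n)%N -> z N <= z n * nth_root n (a N)%:R.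
Proof.
move=> N0 n0; have zN0 : 0 <= z N by exact: nth_root_ge0.
rewrite -nth_rootM // -natrM.
rewrite -(@ler_pXn2r _ (N * n)%N) ?muln_gt0 ?N0 ?nnegrE ?nth_root_ge0 //.
rewrite [leLHS]exprM (mulnC N) [leRHS]exprM !nth_root_expn //.
by rewrite -!natrX ler_nat supermul_expn_le.
Qed.

Lemma seq_root_le_base n : (0 < n)%N -> z n <= b%:R.
Proof.
move=> n0; rewrite -(@ler_pXn2r _ n) ?nnegrE ?nth_root_ge0 //.
by rewrite nth_root_expn // -natrX ler_nat.
Qed.

Lemma seq_root_ge1 n : 1 <= z n.
Proof.
have -> : 1 = nth_root n 1 :> R by rewrite /nth_root powR1.
by rewrite ler_nth_root // ler1n.
Qed.

(** The value at 0 is 1 by convention; it is harmless in the supremum because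
    every other value is at least 1. *)
Lemma seq_root0_le n : z 0 <= z n.
Proof. by rewrite {1}/z /nth_root invr0 powRr0 seq_root_ge1. Qed.

Lemma seq_root_le_sup n : z n <= sup (range z).
Proof.
apply: sup_upper_bound; last by exists n.
split; first by exists (z 0), 0%N.
exists b%:R => _ [m _ <-].
case: m => [|m]; last exact: seq_root_le_base.
exact: le_trans (seq_root0_le 1) (seq_root_le_base 1 _).
Qed.

(** Given eps, some z_N is within eps of the supremum.  For this fixed N the
    lower bound z_N / a_N ^ (1/n) on z_n tends to z_N, so z_n is eventually within
    eps as well. *)
Lemma supermul_root_cvg : (z n @[n --> \oo] --> sup (range z))%classic.
Proof.
have z_sup : has_sup (range z).
  split; first by exists (z 0), 0%N.
  by exists (sup (range z)) => _ [m _ <-]; exact: seq_root_le_sup.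
apply/cvgrPdist_lt => eps eps0.
have [_ [N' _ <-] zN'] := sup_adherent eps0 z_sup.
(* An index 0 may be replaced by 1, so that N-th roots are genuine. *)
have [N N0 zN] : exists2 N, (0 < N)%N & sup (range z) - eps < z N.
  case: N' zN' => [zN'|N' zN']; last by exists N'.+1.
  by exists 1%N => //; exact: lt_le_trans zN' (seq_root0_le 1).
have aN0 : 0 < (a N)%:R :> R by rewrite ltr0n.
have lim_lb : (z N / nth_root n (a N)%:R @[n --> \oo] --> z N)%classic.
  rewrite -[X in (_ --> X)%classic]divr1; apply: cvgM; first exact: cvg_cst.
  by apply: cvgV; [exact: oner_neq0|exact: nth_root_cvg1].
near=> n.
rewrite ger0_norm ?subr_ge0 ?seq_root_le_sup // ltrBlDr -ltrBlDl.
apply: (@lt_le_trans _ _ (z N / nth_root n (a N)%:R)).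
  by near: n; exact: (cvgr_gt _ lim_lb).
rewrite ler_pdivrMr ?powR_gt0 //; apply: supermul_root_le => //.
by near: n; exact: nbhs_infty_gt.
Unshelve. all: by end_near. Qed.

End Fekete.

Theorem theorem1p5 (R : realType) :
  (forall k n : nat, (0 < k)%N -> (0 < n)%N -> (k <= n)%N ->
     zeta_max R k n \in `[1, 2]) /\
  (forall (k : nat) (T : finType) (e : rel T),
     (0 < k)%N -> (0 < #|T|)%N -> simple_graph e ->
     ((zeta R k e)%:E <= limn_einf (fun n : nat => (zeta_max R k n)%:E))%E) /\
  (forall k : nat, (0 < k)%N -> cvgn (fun n : nat => zeta_max R k n)).
Proof.
have zeta_cvg k := @supermul_root_cvg R _ 2 (mi_max_gt0 k) (mi_max_supermul k)
  (mi_max_le_exp2 k).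
split=> [k n _ n0 _|].
  rewrite in_itv /= seq_root_ge1 ?(seq_root_le_base _ 2) //.
  - exact: mi_max_le_exp2.
  - exact: mi_max_gt0.
split=> [k T e _ _ e_simple|k _]; last first.
  by apply/cvg_ex; eexists; exact: zeta_cvg.
have zetaE_cvg : ((zeta_max R k n)%:E @[n --> \oo] -->
    (sup (range (zeta_max R k)))%:E)%classic.
  by apply: cvg_EFin; [exact: nearW|exact: zeta_cvg].
rewrite (cvg_limn_einf_sup zetaE_cvg).1 lee_fin.
apply: (@le_trans _ _ (zeta_max R k #|T|)).
  by rewrite ler_nth_root // ler_nat mi_le_mi_max.
by apply: (seq_root_le_sup _ 2); [exact: mi_max_gt0|exact: mi_max_le_exp2].
Qed.
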